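(* Let $V:(0,\infty)\to\mathbb{R}$ be a real-valued locally integrable potential, i.e. $\int_0^x |V(t)|\,dt<\infty$ for all $x>0$. Fix $a>0$. Then there exists a function $h:(0,\infty)\to\mathbb{R}$ with $$h(x)=O\left(\frac1x\left(1+\int_0^x |V(t)|\,dt\right)\right),\qquad x\to\infty,$$ such that for any $X>0$ and any interval $[\alpha,\beta]\subset[a,\infty)$ of size $|\beta-\alpha|\ge h(X)$, the operator $H_X$ has at least one eigenvalue in $[\alpha^2/4,\beta^2/4]$.
   Context: For $X\in(0,\infty)$, $H_X=-\frac{d^2}{dx^2}+V$ denotes the Schrödinger operator on $L^2((0,X))$ with Dirichlet boundary conditions at $0$ and at $X$. It has only discrete spectrum. A real number $E$ is an eigenvalue of $H_X$ if and only if there is a not identically zero function $u$ on $[0,X]$ with $u,u'$ absolutely continuous on $[0,X]$, $-u''+Vu=Eu$ almost everywhere on $(0,X)$, and $u(0)=u(X)=0$. *)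

(* Defs.v *)
From mathcomp Require Import all_boot all_order all_algebra.
From mathcomp Require Import all_classical all_reals all_analysis.

Set Implicit Arguments.
Unset Strict Implicit.
Unset Printing Implicit Defensive.

Import Order.TTheory GRing.Theory Num.Theory.
Import numFieldNormedType.Exports.

Local Open Scope classical_set_scope.
Local Open Scope ring_scope.

(* [completed_lebesgue_measure] rather than [lebesgue_measure]: with the latter,
   whose sigma-algebra is that of the Borel sets, "integrable" would restrict
   potentials to Borel functions. *)
Notation leb R := (@completed_lebesgue_measure R).

(* Makes [f =O_ (+oo_R) g] typecheck. *)
Canonical pinfty_filter_on (R : numFieldType) :=
  FilterType (pinfty_nbhs R) _.

Definition absolutely_continuous (R : realType) (a b : R) (f : R -> R) : Prop :=
  forall e : R, 0 < e -> exists2 d : R, 0 < d &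
    forall (n : nat) (s t : 'I_n -> R),
      (forall i, a <= s i /\ s i < t i /\ t i <= b) ->
      trivIset [set: 'I_n] (fun i => [set` `]s i, t i[]) ->
      \sum_(i < n) (t i - s i) < d ->
      \sum_(i < n) `|f (t i) - f (s i)| < e.

Definition L2 (R : realType) (X : R) (f : R -> R) : Prop :=
  (f \_ `]0, X[) \in Lfun (leb R) 2%:E.

(* The graph of H_X = - d^2/dx^2 + V with Dirichlet conditions at 0 and X: [u]
   is in the domain and H_X u = f in L^2((0, X)).  The representative of u in
   its L^2 class is the absolutely continuous one.  Functions on [0, X] are
   encoded as functions on R whose values outside [0, X] are irrelevant, so u'
   is given as a function [v] on [0, X] that is the two-sided derivative of [u]
   in the interior; absolute continuity then makes v 0 and v X the one-sided
   derivatives. *)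
Definition schrodinger_dirichlet (R : realType) (V : R -> R) (X : R)
    (u f : R -> R) : Prop :=
  [/\ L2 X u, L2 X f, u 0 = 0, u X = 0 &
    exists v : R -> R,
      [/\ absolutely_continuous 0 X u,
          absolutely_continuous 0 X v,
          forall x, 0 < x < X -> is_derive x 1 u (v x) &
          \forall x \ae leb R, 0 < x < X ->
            derivable v x 1 /\ f x = - derive1 v x + V x * u x]].

Definition schrodinger_eigenvalue (R : realType) (V : R -> R) (X E : R) : Prop :=
  exists2 u : R -> R, (exists2 x, 0 <= x <= X & u x != 0) &
    schrodinger_dirichlet V X u (fun x => E * u x).

(* Main.v *)
Require Import Defs.
From mathcomp Require Import all_boot all_order all_algebra.
From mathcomp Require Import all_classical all_reals all_analysis.
From mathcomp Require Import ring lra.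

Set Implicit Arguments.
Unset Strict Implicit.
Unset Printing Implicit Defensive.

Import Order.TTheory GRing.Theory Num.Theory.
Import numFieldNormedType.Exports.

Local Open Scope classical_set_scope.
Local Open Scope ring_scope.

(* Write a solution of -u'' + Vu = k^2 u, u(0) = 0, as u = r sin(theta),
   u' = k r cos(theta).  The Pruefer angle theta solves
   theta' = k - (V/k) sin(theta)^2, theta(0) = 0, and k^2 is an eigenvalue of
   H_X as soon as theta(X) is a multiple of pi.  Since
   |theta(X) - k X| <= (1/k) \int_0^X |V|, theta(X) increases by at least pi
   when k runs from alpha/2 to beta/2, provided
   (beta - alpha) X >= 2 pi + (8/a) \int_0^X |V|.  As theta(X) is continuous
   in k, it meets a multiple of pi in between.

   With V merely integrable, "f is the derivative of F" is read as "F is an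
   indefinite integral of f" ([is_prim]), and V is replaced by a Borel function
   W equal to V almost everywhere on (0, X). *)

(** * Indefinite integrals of integrable functions and their calculus *)

Definition L1 (R : realType) (f : R -> R) : Prop :=
  (@lebesgue_measure R).-integrable setT (EFin \o f).

(** Integrating from $-\infty$ gives every [x] a primitive value without a sign convention for
    integrals over reversed intervals. *)
Definition prim (R : realType) (f : R -> R) (x : R) : R :=
  \int[@lebesgue_measure R]_(t in `]-oo, x]) f t.

Section primitives.
Context {R : realType}.
Notation mu := (@lebesgue_measure R).
Implicit Types (f g h F G H P : R -> R) (x y c M e : R).

Lemma L1_sub f (A : set R) : measurable A -> L1 f ->
  mu.-integrable A (EFin \o f).
Proof. by move=> mA; exact: integrableS. Qed.

Lemma L1D f g : L1 f -> L1 g -> L1 (fun x => f x + g x).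
Proof. by move=> lf lg; exact: (integrableD measurableT lf lg). Qed.

Lemma L1Z c f : L1 f -> L1 (fun x => c * f x).
Proof. by move=> lf; exact: (integrableZl measurableT _ lf). Qed.

Lemma L1_norm f : L1 f -> L1 (fun x => `|f x|).
Proof. by move=> lf; exact: (integrable_norm lf). Qed.

Lemma L1_bounded_mul h g M : measurable_fun setT h ->
  (forall x, `|h x| <= M) -> L1 g -> L1 (fun x => h x * g x).
Proof.
move=> mh hM lg; rewrite /L1 (_ : EFin \o _ = ((EFin \o h) \* (EFin \o g))%E)//.
apply: integrableMr => //.
exists M; split; first exact: num_real.
by move=> y My x _; rewrite /= (le_trans (hM x))// ltW.
Qed.

Lemma prim_diff f x y : L1 f -> x <= y ->
  prim f y - prim f x = \int[mu]_(t in `]x, y]) f t.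
Proof.
move=> lf xy; rewrite /prim Rintegral_itvB//.
exact: L1_sub.
Qed.

Lemma primD f g x : L1 f -> L1 g ->
  prim (fun t => f t + g t) x = prim f x + prim g x.
Proof. by move=> lf lg; rewrite /prim RintegralD//; exact: L1_sub. Qed.

Lemma primZ c f x : L1 f -> prim (fun t => c * f t) x = c * prim f x.
Proof. by move=> lf; rewrite /prim RintegralZl//; exact: L1_sub. Qed.

(** Both orders of [x] and [y] are allowed because the lemma serves estimates on two-sided
    neighbourhoods. *)
Lemma prim_diff_le f g e x y : 0 <= e -> L1 f -> L1 g ->
  (forall t, Num.min x y <= t <= Num.max x y -> `|f t| <= e * g t) ->
  `|prim f y - prim f x| <= e * `|prim g y - prim g x|.
Proof.
move=> e0 lf lg; wlog xy : x y / x <= y => [wlg fg|].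
  have [xy|/ltW yx] := leP x y; first exact: wlg.
  rewrite distrC (distrC (prim g y)); apply: wlg => // t.
  by rewrite minC maxC; exact: fg.
rewrite (min_idPl xy) (max_idPr xy) => fg.
rewrite !prim_diff//.
apply: (@le_trans _ _ (\int[mu]_(t in `]x, y]) (e * g t))); last first.
  by rewrite RintegralZl//; [rewrite ler_wpM2l// ler_norm|exact: L1_sub].
apply: (@le_trans _ _ (\int[mu]_(t in `]x, y]) `|f t|)).
  by apply: le_normr_Rintegral => //; exact: L1_sub.
apply: le_Rintegral => //; [exact/L1_sub/L1_norm|exact/L1_sub/L1Z|].
by move=> t /=; rewrite in_itv/= => /andP[xt ty]; apply: fg; rewrite ty ltW.
Qed.

Lemma prim_nondecreasing g x y : L1 g -> (forall t, 0 <= g t) -> x <= y ->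
  prim g x <= prim g y.
Proof. by move=> lg g0 xy; rewrite -subr_ge0 prim_diff// Rintegral_ge0. Qed.

Lemma prim_ge0 g x : (forall t, 0 <= g t) -> 0 <= prim g x.
Proof. by move=> g0; exact: Rintegral_ge0. Qed.

Lemma prim_le_norm f x : L1 f -> `|prim f x| <= prim (fun t => `|f t|) x.
Proof. by move=> lf; apply: le_normr_Rintegral => //; exact: L1_sub. Qed.

Lemma prim_norm_le_int f x : L1 f ->
  prim (fun t => `|f t|) x <= \int[mu]_t `|f t|.
Proof.
move=> lf; have lf' := L1_norm lf; rewrite /prim Rintegral_mkcond.
have mN : measurable (`]-oo, x] : set R) by [].
apply: le_Rintegral => //.
  have [+ _] := integrable_mkcond (mu := mu) (fun t => `|f t|%:E) mN.
  by rewrite restrict_EFin; apply; exact: L1_sub.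
by move=> t _; rewrite patchE; case: ifP => _; rewrite ?normr_id ?normr_ge0.
Qed.

Lemma prim_continuous f : L1 f -> continuous (prim f).
Proof.
move=> lf z; apply/cvgrPdist_lt => /= e e0.
have [d [d0 fd]] := integral_normr_continuous lf e0.
suff close x y : `|x - y| < d -> `|prim f x - prim f y| < e.
  by near=> y; apply: close; near: y; exact: cvgr_dist_lt.
wlog xy : x y / x <= y => [wlg dxy|dxy].
  have [xy|/ltW yx] := leP x y; first exact: wlg.
  by rewrite distrC; apply: wlg; rewrite // distrC.
rewrite distrC prim_diff//.
apply: (@le_lt_trans _ _ (\int[mu]_(t in `]x, y]) `|f t|)).
  by apply: le_normr_Rintegral => //; exact: L1_sub.
apply: fd => //.
rewrite /= lebesgue_measure_itv/= lte_fin; case: ifP => _; rewrite lte_fin//.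
by rewrite (le_lt_trans _ dxy)// distrC ler_norm.
Unshelve. all: by end_near. Qed.

(* Stands in for "an absolutely continuous function whose derivative vanishes
   almost everywhere is constant". *)
Lemma locally_const H P :
  (forall x y, x <= y -> P x <= P y) ->
  (forall x e, 0 < e ->
    \forall y \near x, `|H y - H x| <= e * `|P y - P x|) ->
  forall x y, H x = H y.
Proof.
move=> ndP locH.
suff ab a b : a < b -> H a = H b.
  by move=> x y; have [/ab|/ab|->] := ltgtP x y.
move=> ltab; suff small e : 0 < e -> `|H b - H a| <= e * (P b - P a).
  apply/eqP; rewrite eq_sym -subr_eq0 -normr_le0; apply/ler_addgt0Pl => e e0.
  have Pab : 0 <= P b - P a by rewrite subr_ge0 ndP// ltW.
  (* The summand 1 keeps the denominator positive when [P b = P a]. *)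
  have c0 : 0 < e / (P b - P a + 1) by rewrite divr_gt0//; lra.
  rewrite addr0 (le_trans (small _ c0))// -mulrA ger_pMr//.
  by rewrite ler_pdivrMl; lra.
move=> e0.
(* Continuous induction: [A] contains its supremum [s], and if [s < b] the local bound at [s] puts a
   larger point into [A]. *)
pose A := [set x | a <= x <= b /\ `|H x - H a| <= e * (P x - P a)].
have Aa : A a by split; [rewrite lexx ltW|rewrite !subrr normr0 mulr0].
have supA : has_sup A by split; [exists a|exists b => x [/andP[]]].
set s := sup A.
have le_as : a <= s by exact: (ub_le_sup supA.2).
have sb : s <= b by apply: ge_sup; [exists a|move=> x [/andP[]]].
have [d /= d0 dH] := locH s e e0.
have As : A s.
  have [x Ax xs] := sup_adherent d0 supA.
  have xs' : x <= s by exact: (ub_le_sup supA.2).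
  split; first by rewrite le_as sb.
  case: Ax => _ Hx.
  have := dH x; rewrite /ball/= => /(_ _)/wrap[].
    rewrite ger0_norm ?subr_ge0//; rewrite -/s in xs; lra.
  rewrite distrC (distrC (P x)) (ger0_norm (_ : 0 <= P s - P x)) ?subr_ge0 ?ndP//.
  move=> Hs; rewrite (le_trans (ler_distD (H x) _ _))//.
  by rewrite (le_trans (lerD Hs Hx))//; lra.
move: sb; rewrite le_eqVlt => /predU1P[<-|sb]; first by case: As.
pose y := Num.min b (s + d / 2).
have sy : s < y by rewrite lt_min sb/=; lra.
have yb : y <= b by rewrite ge_min lexx.
suff Ay : A y by have := ub_le_sup supA.2 Ay; rewrite leNgt sy.
split; first by rewrite yb (le_trans le_as)// ltW.
case: As => _ Hs.
have := dH y; rewrite /ball/= => /(_ _)/wrap[].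
  rewrite ltr0_norm ?subr_lt0// opprB.
  have : y <= s + d / 2 by rewrite ge_min lexx orbT.
  lra.
rewrite (ger0_norm (_ : 0 <= P y - P s)) ?subr_ge0 ?ndP ?(ltW sy)// => Hy.
rewrite (le_trans (ler_distD (H s) _ _))//.
by rewrite (le_trans (lerD Hy Hs))//; lra.
Qed.

(** Only increments are compared, so [F] is free up to a constant. As [f] is integrable on the whole
    line, [F] is bounded, which supplies the global bounds needed in the chain rule. *)
Definition is_prim F f := L1 f /\ forall x y, F y - F x = prim f y - prim f x.

Lemma is_prim_prim f : L1 f -> is_prim (prim f) f.
Proof. by []. Qed.

Lemma is_prim_eq F f g : f =1 g -> is_prim F f -> is_prim F g.
Proof. by move=> /funext ->. Qed.

Lemma is_primD F G f g : is_prim F f -> is_prim G g ->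
  is_prim (fun x => F x + G x) (fun x => f x + g x).
Proof.
move=> [lf Ff] [lg Gg]; split; first exact: L1D.
move=> x y; rewrite !primD//; have := Ff x y; have := Gg x y; lra.
Qed.

Lemma is_primZ c F f : is_prim F f ->
  is_prim (fun x => c * F x) (fun x => c * f x).
Proof.
move=> [lf Ff]; split; first exact: L1Z.
by move=> x y; rewrite !primZ// -!mulrBr Ff.
Qed.

Lemma is_prim_continuous F f : is_prim F f -> continuous F.
Proof.
move=> [lf Ff] x.
have -> : F = (fun y => prim f y + (F x - prim f x)).
  by apply/funext => y; have := Ff x y; lra.
by apply: cvgD; [exact: prim_continuous|exact: cvg_cst].
Qed.

Lemma is_prim_bounded F f : is_prim F f -> exists M, forall x, `|F x| <= M.
Proof.
move=> [lf Ff]; exists (`|F 0 - prim f 0| + \int[mu]_t `|f t|) => x.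
have -> : F x = F 0 - prim f 0 + prim f x by have := Ff 0 x; lra.
rewrite (le_trans (ler_normD _ _))// lerD2l.
exact: le_trans (prim_le_norm _ lf) (prim_norm_le_int _ lf).
Qed.

Lemma is_prim_diff_le F f x y : is_prim F f ->
  `|F y - F x| <= `|prim (fun t => `|f t|) y - prim (fun t => `|f t|) x|.
Proof.
move=> [lf ->]; rewrite -[leRHS]mul1r; apply: prim_diff_le => //.
  exact: L1_norm.
by move=> t _; rewrite mul1r.
Qed.

(** The form without a quotient also holds at [t = x]. It can therefore be composed with [F], where
    [F t = F x] may occur for [t] different from [x]. *)
Lemma is_derive_nearP (phi : R -> R) (x d : R) : is_derive x (1 : R) phi d <->
  forall e, 0 < e ->
    \forall t \near x, `|phi t - phi x - d * (t - x)| <= e * `|t - x|.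
Proof.
have quotE (h : R) : h != 0 -> d - h^-1 *: ((phi \o shift x) (h *: 1) - phi x) =
    - (h^-1 * (phi (x + h) - phi x - d * h)).
  by move=> h0; rewrite /= scaler1 (addrC h) mulrBr mulrCA mulVf// mulr1 opprB.
split=> [[dphi dphiE] e e0|H].
  have /cvgrPdist_le/(_ _ e0)[r /= r0 Hr] := dphi.
  exists r => //= t xt; have [->|tx] := eqVneq t x.
    by rewrite !subrr mulr0 subr0 normr0 mulr0.
  have tx0 : t - x != 0 by rewrite subr_eq0.
  have := Hr (t - x); rewrite /= sub0r normrN (distrC t) => /(_ xt tx0).
  move: dphiE; rewrite /derive /= => ->.
  have := quotE _ tx0; rewrite /= scaler1 subrK (addrC x) subrK => ->.
  by rewrite normrN normrM normfV (distrC x t) (mulrC e) ler_pdivrMl ?normr_gt0.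
suff : h^-1 *: ((phi \o shift x) (h *: 1) - phi x) @[h --> 0^'] --> d.
  move=> cd; split; first by apply/cvg_ex; exists d.
  exact/cvg_lim.
apply/cvgrPdist_le => e e0; have [r /= r0 Hr] := H e e0.
exists r => //= h; rewrite /= sub0r normrN => hr h0.
have := quotE h h0; rewrite /= => ->.
rewrite normrN normrM normfV ler_pdivrMl ?normr_gt0// (mulrC _ e).
have := Hr (x + h); rewrite /= (addrAC x h) subrr add0r.
by rewrite (distrC x) (addrAC x h) subrr add0r; apply.
Qed.

(** The difference of [phi \o F] and the primitive of [dphi (F x) * f x] is locally constant in the
    sense of [locally_const], with [P] the primitive of [|f|]: differentiability of [phi] and
    continuity of [dphi \o F] each contribute an error of at most [e / 2] times the increment of
    [P]. *)
Lemma is_prim_comp F f (phi dphi : R -> R) M : is_prim F f ->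
  (forall x : R, is_derive x (1 : R) phi (dphi x)) -> continuous dphi ->
  (forall x, `|dphi (F x)| <= M) ->
  is_prim (phi \o F) (fun x => dphi (F x) * f x).
Proof.
move=> Ff dphiE cdphi dphiM; have cF := is_prim_continuous Ff.
have cdF : continuous (fun x => dphi (F x)).
  by move=> x; apply: continuous_comp; [exact: cF|exact: cdphi].
have [lf FE] := Ff.
have lg : L1 (fun x => dphi (F x) * f x).
  apply: L1_bounded_mul lf; last exact: dphiM.
  exact: measurable_realfun.continuous_measurable_fun.
split=> // x0 y0; set g := fun x => dphi (F x) * f x.
pose P := prim (fun t => `|f t|).
suff : forall x y, phi (F x) - prim g x = phi (F y) - prim g y.
  by move=> /(_ x0 y0) /=; lra.
apply: (@locally_const _ P).
  by move=> x y xy; apply: prim_nondecreasing => //; exact: L1_norm.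
move=> x e e0; have e20 : 0 < e / 2 by rewrite divr_gt0.
have [d1 /= d10 Hd1] : \forall t \near x, `|dphi (F x) - dphi (F t)| <= e / 2.
  by have /cvgrPdist_le := cdF x; exact.
have phiF : \forall t \near F x,
    `|phi t - phi (F x) - dphi (F x) * (t - F x)| <= e / 2 * `|t - F x|.
  by have [+ _] := is_derive_nearP phi (F x) (dphi (F x)); apply.
have [d2 /= d20 Hd2] : \forall t \near x,
    `|phi (F t) - phi (F x) - dphi (F x) * (F t - F x)| <= e / 2 * `|F t - F x|.
  exact: cF phiF.
exists (Num.min d1 d2) => /=; first by rewrite lt_min d10.
move=> y; rewrite /= lt_min => /andP[xy1 xy2].
(* The first summand is the linearization error of [phi] at [F x]; the second is the cost of
   freezing the factor [dphi (F t)] at [t = x]. *)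
have -> : phi (F y) - prim g y - (phi (F x) - prim g x) =
    (phi (F y) - phi (F x) - dphi (F x) * (F y - F x)) +
    (prim (fun t => dphi (F x) * f t + -1 * g t) y -
     prim (fun t => dphi (F x) * f t + -1 * g t) x).
  rewrite !(primD, primZ)//; [|exact: L1Z..].
  by rewrite FE; ring.
rewrite (le_trans (ler_normD _ _))// (splitr e) mulrDl lerD//.
  rewrite (le_trans (Hd2 y xy2))// ler_wpM2l ?(ltW e20)//.
  exact: is_prim_diff_le.
apply: prim_diff_le; [exact: ltW|by apply: L1D; exact: L1Z|exact: L1_norm|].
move=> t /andP[mt tM]; rewrite /g mulN1r -mulrBl normrM ler_wpM2r//.
apply: Hd1 => /=; rewrite (le_lt_trans _ xy1)//.
move: mt tM; rewrite ge_min le_max => mt tM.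
have [xy|yx] := leP x y.
  rewrite !ler0_norm; lra.
rewrite !ger0_norm; lra.
Qed.

Lemma is_prim_sqr F f : is_prim F f ->
  is_prim (fun x => F x ^+ 2) (fun x => 2 * F x * f x).
Proof.
move=> Ff; have [M FM] := is_prim_bounded Ff.
apply: (@is_prim_comp F f (fun x => x ^+ 2) (fun x => 2 * x) (2 * M) Ff).
- move=> x; rewrite [X in is_derive _ _ X _](_ : _ = id ^+ 2).
    by apply: is_derive_eq; rewrite /= expr1 scaler1.
  by [].
- by move=> x; apply: mulrl_continuous.
- by move=> x; rewrite normrM ger0_norm// ler_wpM2l.
Qed.

(* By polarization, from the chain rule for squares. *)
Lemma is_primM F G f g : is_prim F f -> is_prim G g ->
  is_prim (fun x => F x * G x) (fun x => f x * G x + F x * g x).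
Proof.
move=> Ff Gg.
have := is_primZ 4^-1 (is_primD (is_prim_sqr (is_primD Ff Gg))
  (is_primZ (-1) (is_prim_sqr (is_primD Ff (is_primZ (-1) Gg))))).
have -> : (fun x => F x * G x) =
    (fun x => 4^-1 * ((F x + G x) ^+ 2 + -1 * (F x + -1 * G x) ^+ 2)).
  by apply/funext => x; field.
by apply: is_prim_eq => x; field.
Qed.

Lemma is_prim_expR F f : is_prim F f ->
  is_prim (fun x => expR (F x)) (fun x => expR (F x) * f x).
Proof.
move=> Ff; have [M FM] := is_prim_bounded Ff.
apply: (@is_prim_comp F f expR expR (expR M) Ff).
- exact: continuous_expR.
- move=> x; rewrite ger0_norm ?expR_ge0// ler_expR.
  by rewrite (le_trans _ (FM x))// ler_norm.
Qed.

Lemma norm_cos_le1 x : `|cos x| <= 1.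
Proof. by rewrite ler_norml cos_geN1 cos_le1. Qed.

Lemma norm_sin_le1 x : `|sin x| <= 1.
Proof. by rewrite ler_norml sin_geN1 sin_le1. Qed.

Lemma is_prim_sin F f : is_prim F f ->
  is_prim (fun x => sin (F x)) (fun x => cos (F x) * f x).
Proof.
move=> Ff; apply: (@is_prim_comp F f sin cos 1 Ff).
- exact: continuous_cos.
- by move=> x; exact: norm_cos_le1.
Qed.

Lemma is_prim_cos F f : is_prim F f ->
  is_prim (fun x => cos (F x)) (fun x => - sin (F x) * f x).
Proof.
move=> Ff; apply: (@is_prim_comp F f cos (fun x => - sin x) 1 Ff).
- by move=> x; apply: cvgN; exact: continuous_sin.
- by move=> x; rewrite normrN; exact: norm_sin_le1.
Qed.

End primitives.

(** * Picard iteration for the Pruefer angle, with Lipschitz dependence on k *)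

Section picard.
Context {R : realType}.
Notation mu := (@lebesgue_measure R).

(** The sequences [w] and [v], obtained by subtracting and adding the tail bound, are nondecreasing
    and nonincreasing with [w] below [v]; the supremum of [w] lies between them. *)
Lemma geometric_cauchy (u : nat -> R) (c : R) :
  (forall j, `|u j.+1 - u j| <= c / 2 ^+ j) ->
  exists l, forall j, `|l - u j| <= 2 * c / 2 ^+ j.
Proof.
move=> uc; have pow2 j : 2 * c / 2 ^+ j.+1 = c / 2 ^+ j.
  by rewrite exprS invfM mulrACA mulfV// mul1r.
have c0 j : 0 <= c / 2 ^+ j by rewrite (le_trans _ (uc j)).
pose v j := u j + 2 * c / 2 ^+ j; pose w j := u j - 2 * c / 2 ^+ j.
have vS j : v j.+1 <= v j.
  rewrite /v pow2; have := uc j; rewrite ler_norml => /andP[].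
  have := c0 j; set r := 2 ^+ j; rewrite -!mulrA; lra.
have wS j : w j <= w j.+1.
  rewrite /w pow2; have := uc j; rewrite ler_norml => /andP[].
  have := c0 j; set r := 2 ^+ j; rewrite -!mulrA; lra.
have ndw : {homo w : i j / (i <= j)%N >-> i <= j}.
  exact: homo_leq lexx le_trans wS.
have niv : {homo v : i j / (i <= j)%N >-> j <= i}.
  apply: (@homo_leq _ v (fun a b => b <= a)) => // x y z yx zy.
  exact: le_trans zy yx.
have wv i j : w i <= v j.
  rewrite (le_trans (ndw _ _ (leq_maxl i j)))//.
  rewrite (le_trans _ (niv _ _ (leq_maxr i j)))// /w /v.
  have := c0 (maxn i j); rewrite -!mulrA; lra.
have hs : has_sup (range w).
  by split; [exists (w 0), 0|exists (v 0) => _ [i _ <-]].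
exists (sup (range w)) => j.
have wl : w j <= sup (range w) by apply: (ub_le_sup hs.2); exists j.
have lv : sup (range w) <= v j.
  by apply: ge_sup; [exists (w 0), 0|move=> _ [i _ <-]].
by rewrite ler_norml; move: wl lv; rewrite /w /v; lra.
Qed.

(** Carries estimates for the Picard iterates over to their limit. The error falls below any [e]
    because $2^N > N > c/e$. *)
Lemma ler_geometric (x y c : R) : (forall j, x <= y + c / 2 ^+ j) -> x <= y.
Proof.
move=> xy; apply/ler_addgt0Pl => e e0.
have [N cN] : exists N : nat, c / e < N%:R.
  exists (Num.bound `|c / e|).
  by rewrite (le_lt_trans (ler_norm _))// archi_boundP.
have := xy N; suff : c / 2 ^+ N <= e by lra.
have N0 : 0 < (2 : R) ^+ N by rewrite exprn_gt0.
rewrite ler_pdivrMr// mulrC -ler_pdivrMr//.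
rewrite (le_trans (ltW cN))// -natrX ler_nat ltnW// ltn_expl//.
Qed.

Lemma dist_le_via (x y x' y' a b c : R) : `|x - x'| <= a -> `|y - y'| <= b ->
  `|x' - y'| <= c -> `|x - y| <= c + (a + b).
Proof.
move=> xa yb xyc; have -> : x - y = (x' - y') + ((x - x') - (y - y')) by ring.
rewrite (le_trans (ler_normD _ _))// lerD// (le_trans (ler_normB _ _))//.
exact: lerD.
Qed.

(** Factor the difference of squares: sine is 1-Lipschitz by the mean value theorem, and the sum of
    two sines is at most 2 in absolute value. *)
Lemma sqr_sin_lipschitz (x y : R) : `|sin x ^+ 2 - sin y ^+ 2| <= 2 * `|x - y|.
Proof.
have sin_lip (s t : R) : s < t -> `|sin t - sin s| <= t - s.
  move=> st; have [] := @MVT R sin cos s t st.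
  - by apply: continuous_subspaceT; exact: continuous_sin.
  have ts : 0 <= t - s by rewrite subr_ge0 ltW.
  by move=> z _ ->; rewrite normrM (ger0_norm ts) ler_piMl ?norm_cos_le1.
have lip : `|sin x - sin y| <= `|x - y|.
  have [xy|xy|->] := ltgtP x y; last by rewrite !subrr.
    rewrite distrC (le_trans (sin_lip _ _ xy))// distrC ler_norm//.
  by rewrite (le_trans (sin_lip _ _ xy))// ler_norm.
rewrite subr_sqr normrM mulrC ler_pM//.
rewrite (le_trans (ler_normD _ _))//.
by have := norm_sin_le1 x; have := norm_sin_le1 y; lra.
Qed.

Variables (X c : R) (W : R -> R).
Hypotheses (X0 : 0 < X) (c0 : 0 < c) (LW : L1 W).
Hypothesis (W0 : forall t, t <= 0 -> W t = 0).

(** Cuts the constant term k of the angle equation off outside $(0,X]$, so that the right side is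
    integrable on the whole line. *)
Let D : R -> R := \1_`]0, X].
(** A Bielecki weight: $E' = (4/c)|W|E$ in the integrated sense, so integrating $|W|E$ from 0 gives
    $(c/4)(E-1)$. *)
Let E (x : R) := expR (4 / c * prim (fun t => `|W t|) x).

Let LD : L1 D. Proof. exact: integrable_indic_itv. Qed.

Lemma prim_eq0 (f : R -> R) x : (forall t, t <= 0 -> f t = 0) -> x <= 0 ->
  prim f x = 0.
Proof.
move=> f0 x0; rewrite /prim (@eq_Rintegral _ _ _ mu _ (cst 0)).
  by rewrite Rintegral_cst// mul0r.
by move=> t; rewrite inE/= in_itv/= => tx; rewrite f0// (le_trans tx).
Qed.

Lemma prim_indic_le x : 0 <= prim D x <= X.
Proof.
have D0 t : 0 <= D t by rewrite /D indicE.
rewrite prim_ge0//= (le_trans (ler_norm _))// (le_trans (prim_le_norm _ LD))//.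
rewrite (le_trans (prim_norm_le_int _ LD))//.
under eq_Rintegral do rewrite ger0_norm//.
rewrite /D /Rintegral integral_indic//= setIT lebesgue_measure_itv/= lte_fin X0.
by rewrite oppr0 adde0.
Qed.

Lemma norm_sqr_sin_le1 (x : R) : `|sin x ^+ 2| <= 1.
Proof. by rewrite normrX exprn_ile1// norm_sin_le1. Qed.

Let E_ge1 x : 1 <= E x.
Proof. by rewrite -expR0 ler_expR mulr_ge0 ?prim_ge0// divr_ge0 ?ltW. Qed.

Let E0 : E 0 = 1.
Proof.
by rewrite /E prim_eq0 ?mulr0 ?expR0// => t t0; rewrite W0 ?normr0.
Qed.

Let is_prim_E : is_prim E (fun x => E x * (4 / c * `|W x|)).
Proof. exact/is_prim_expR/is_primZ/is_prim_prim/L1_norm/LW. Qed.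

(* The weight [E] absorbs the Lipschitz constant of the integral operator. *)
Lemma weighted_prim_le (h : R -> R) (N x : R) : 0 <= N ->
  L1 (fun t => h t * W t) -> (forall t, `|h t| <= N * E t) ->
  `|prim (fun t => h t * W t) x| <= N * (c / 4) * E x.
Proof.
move=> N0 lh hN; have [lE PE] := is_prim_E.
have h0 : prim (fun t => h t * W t) 0 = 0.
  by apply: prim_eq0 => // t t0; rewrite W0 ?mulr0.
have c40 : 0 < c / 4 by rewrite divr_gt0.
rewrite -[prim _ x]subr0 -[in X in _ - X]h0.
apply: (@le_trans _ _ (N * (c / 4) * `|E x - E 0|)); last first.
  rewrite ler_wpM2l ?mulr_ge0 ?(ltW c0)//.
  by rewrite E0 ger0_norm ?subr_ge0// gerBl.
rewrite PE; apply: prim_diff_le => // [|t _]; first by rewrite mulr_ge0// ltW.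
rewrite normrM.
have -> : N * (c / 4) * (E t * (4 / c * `|W t|)) = N * E t * `|W t|.
  by field; rewrite gt_eqF.
by rewrite ler_wpM2r.
Qed.

(** Right side of the Pruefer equation $\theta' = kD - (W/k)\sin^2\theta$. *)
Definition prufer_field (k : R) (th : R -> R) (t : R) :=
  k * D t + - k^-1 * (sin (th t) ^+ 2 * W t).

Fixpoint prufer_picard (k : R) (j : nat) : R -> R :=
  if j is i.+1 then prim (prufer_field k (prufer_picard k i)) else fun=> 0.

Lemma L1_sqr_sin (th : R -> R) : continuous th ->
  L1 (fun t => sin (th t) ^+ 2 * W t).
Proof.
move=> cth; apply: (@L1_bounded_mul _ _ _ 1 _ _ LW); last first.
  by move=> x; exact: norm_sqr_sin_le1.
apply: measurable_realfun.continuous_measurable_fun => x.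
apply: (@continuous_comp _ _ _ (fun y => sin (th y)) (fun y => y ^+ 2)).
  by apply: continuous_comp; [exact: cth|exact: continuous_sin].
exact: exprn_continuous.
Qed.

Lemma L1_prufer_field k th : continuous th -> L1 (prufer_field k th).
Proof. by move=> cth; apply: L1D; apply: L1Z => //; exact: L1_sqr_sin. Qed.

Lemma prufer_picard_continuous k j : continuous (prufer_picard k j).
Proof.
elim: j => [|j IH]; first by move=> x; exact: cvg_cst.
exact/prim_continuous/L1_prufer_field.
Qed.

Lemma prim_prufer_field k th x : continuous th ->
  prim (prufer_field k th) x =
  k * prim D x - k^-1 * prim (fun t => sin (th t) ^+ 2 * W t) x.
Proof.
move=> cth; have ls := L1_sqr_sin cth.
by rewrite primD ?primZ ?mulNr//; exact: L1Z.
Qed.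

Lemma prim_sqr_sin_dist (th1 th2 : R -> R) (N x : R) : 0 <= N ->
  continuous th1 -> continuous th2 ->
  (forall t, `|th1 t - th2 t| <= N * E t) ->
  `|prim (fun t => sin (th1 t) ^+ 2 * W t) x -
    prim (fun t => sin (th2 t) ^+ 2 * W t) x| <= N * (c / 2) * E x.
Proof.
move=> N0 c1 c2 th12; have l1 := L1_sqr_sin c1; have l2 := L1_sqr_sin c2.
have l12 : L1 (fun t => (sin (th1 t) ^+ 2 - sin (th2 t) ^+ 2) * W t).
  have := L1D l1 (L1Z (-1) l2); congr (L1 _).
  by apply/funext => t; ring.
have -> : prim (fun t => sin (th1 t) ^+ 2 * W t) x -
    prim (fun t => sin (th2 t) ^+ 2 * W t) x =
    prim (fun t => (sin (th1 t) ^+ 2 - sin (th2 t) ^+ 2) * W t) x.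
  rewrite -mulN1r -primZ// -primD//; last exact: L1Z.
  by congr prim; apply/funext => t; ring.
have -> : N * (c / 2) = (2 * N) * (c / 4) by field.
apply: weighted_prim_le => //; first by rewrite mulr_ge0.
move=> t; rewrite (le_trans (sqr_sin_lipschitz _ _))//.
by rewrite -mulrA ler_wpM2l.
Qed.

(** The integral operator contracts by 1/2 in the norm weighted by [E]: the Lipschitz constant 2 of
    the squared sine, the factor $1/k \le 1/c$ and the gain $c/4$ from the weight multiply to at
    most 1/2. *)
Lemma prufer_step (k : R) (th1 th2 : R -> R) (N x : R) : c <= k -> 0 <= N ->
  continuous th1 -> continuous th2 ->
  (forall t, `|th1 t - th2 t| <= N * E t) ->
  `|prim (prufer_field k th1) x - prim (prufer_field k th2) x| <= N / 2 * E x.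
Proof.
move=> ck N0 c1 c2 th12; have k0 : 0 < k by exact: lt_le_trans ck.
rewrite !prim_prufer_field//.
rewrite opprB addrC addrA subrK -mulrBr normrM gtr0_norm ?invr_gt0//.
rewrite ler_pdivrMl// distrC.
rewrite (le_trans (prim_sqr_sin_dist _ N0 c1 c2 th12))//.
have EN : 0 <= N / 2 * E x.
  by rewrite mulr_ge0 ?divr_ge0// (le_trans _ (E_ge1 x)).
by rewrite (_ : N * _ * _ = c * (N / 2 * E x)) ?ler_wpM2r//; ring.
Qed.

Lemma prufer_picard_cauchy k j x : c <= k ->
  `|prufer_picard k j.+1 x - prufer_picard k j x| <= k * X / 2 ^+ j * E x.
Proof.
move=> ck; have k0 : 0 < k by exact: lt_le_trans ck.
have kX : 0 <= k * X by rewrite mulr_ge0// ltW.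
elim: j x => [|j IH] x.
  (* The zeroth iterate is 0, so the potential term vanishes and the first iterate is
     [k * prim D x], which lies between 0 and [k * X]. *)
  rewrite expr0 invr1 mulr1 subr0 /=.
  rewrite prim_prufer_field; last by move=> ?; exact: cvg_cst.
  have -> : prim (fun t => sin (0 : R) ^+ 2 * W t) x = 0.
    rewrite primZ//.
    by rewrite sin0 expr0n/= mul0r.
  have /andP[D0 DX] := prim_indic_le x.
  rewrite mulr0 subr0 ger0_norm; last by rewrite mulr_ge0// ltW.
  rewrite (@le_trans _ _ (k * X))// ?ler_wpM2l ?(ltW k0)//.
  by rewrite ler_peMr.
rewrite exprSr invfM mulrA; apply: prufer_step => //.
  by rewrite divr_ge0// exprn_ge0.
- exact: (@prufer_picard_continuous k j.+1).
- exact: (@prufer_picard_continuous k j).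
Qed.

Let Mt := \int[mu]_t `|W t|.
(** Changing k to l with the angle fixed moves the integral by at most $(X + M_t/c^2)|k-l|$. Twice
    this constant is reproduced by a contraction of ratio 1/2. *)
Let L := 2 * (X + Mt / c ^+ 2).

Lemma prufer_picard_lipschitz k l j x : c <= k -> c <= l ->
  `|prufer_picard k j x - prufer_picard l j x| <= L * `|k - l| * E x.
Proof.
move=> ck cl; have k0 : 0 < k by exact: lt_le_trans ck.
have l0 : 0 < l by exact: lt_le_trans cl.
have Mt0 : 0 <= Mt by exact: Rintegral_ge0.
have L0 : 0 <= L by rewrite mulr_ge0// addr_ge0 ?(ltW X0)// divr_ge0// sqr_ge0.
have LE y : 0 <= L * `|k - l| * E y.
  by rewrite mulr_ge0 ?(le_trans _ (E_ge1 y))// mulr_ge0.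
elim: j x => [|j IH] x; first by rewrite /= subrr normr0.
rewrite /=.
have cthk := @prufer_picard_continuous k j.
have cthl := @prufer_picard_continuous l j.
(* Compare through the field with parameter [l] and the angle for [k]: the change of parameter and
   the change of angle each cost half of the bound. *)
rewrite (le_trans (ler_distD (prim (prufer_field l (prufer_picard k j)) x) _ _))//.
rewrite (splitr (L * _ * _)) lerD//; last first.
  rewrite (le_trans (prufer_step x cl (mulr_ge0 L0 (normr_ge0 _)) cthk cthl IH))//.
  by rewrite mulrAC.
rewrite !prim_prufer_field//; set S := prim (fun t => sin _ ^+ 2 * W t) x.
have SM : `|S| <= Mt.
  have ls := L1_sqr_sin cthk.
  rewrite (le_trans (prim_le_norm _ ls))// (le_trans (prim_norm_le_int _ ls))//.
  apply: le_Rintegral => //; [exact: L1_norm|exact: L1_norm|].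
  by move=> t _; rewrite normrM ler_piMl// norm_sqr_sin_le1.
have -> : k * prim D x - k^-1 * S - (l * prim D x - l^-1 * S) =
  (k - l) * (prim D x + S / (k * l)).
  by field; rewrite !gt_eqF.
rewrite normrM.
apply: (@le_trans _ _ (`|k - l| * (L / 2))); last first.
  rewrite [leRHS](_ : _ = `|k - l| * (L / 2) * E x); last by ring.
  by rewrite ler_peMr// mulr_ge0// divr_ge0.
rewrite ler_wpM2l// (le_trans (ler_normD _ _))//.
have -> : L / 2 = X + Mt / c ^+ 2 by rewrite /L mulrC mulKf.
have /andP[D0 DX] := prim_indic_le x.
have kl0 : 0 < k * l by rewrite mulr_gt0.
rewrite lerD//; first by rewrite ger0_norm.
rewrite normrM normfV (gtr0_norm kl0) ler_pM ?invr_ge0 ?(ltW kl0)//.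
by rewrite lef_pV2 ?posrE ?exprn_gt0// expr2 ler_pM// ltW.
Qed.

(** The modulus of continuity on the right does not depend on [j], so the pointwise limit of the
    iterates inherits it. *)
Lemma prufer_picard_dist k j x y : c <= k ->
  `|prufer_picard k j y - prufer_picard k j x| <=
  `|prim (fun t => k * D t + k^-1 * `|W t|) y -
    prim (fun t => k * D t + k^-1 * `|W t|) x|.
Proof.
move=> ck; have k0 : 0 < k by exact: lt_le_trans ck.
case: j => [|j]; first by rewrite subrr normr0.
rewrite -[leRHS]mul1r; apply: prim_diff_le => //.
- exact/L1_prufer_field/prufer_picard_continuous.
- by apply: L1D; apply: L1Z => //; exact: L1_norm.
move=> t _; rewrite mul1r (le_trans (ler_normD _ _))// lerD//.
  by rewrite ger0_norm// mulr_ge0 ?(ltW k0)// /D indicE.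
have kV0 : 0 < k^-1 by rewrite invr_gt0.
rewrite normrM normrN (gtr0_norm kV0) ler_wpM2l ?invr_ge0 ?(ltW k0)//.
by rewrite normrM ler_piMl// norm_sqr_sin_le1.
Qed.

Lemma prufer_angle_exists : exists theta : R -> R -> R,
  [/\ forall k, c <= k -> is_prim (theta k) (prufer_field k (theta k)),
      forall k, c <= k -> theta k 0 = 0 &
      forall x, exists K, forall k l, c <= k -> c <= l ->
        `|theta k x - theta l x| <= K * `|k - l| ].
Proof.
pose thetaP k x l := forall j,
  `|l - prufer_picard k j x| <= 2 * (k * X * E x) / 2 ^+ j.
have /choice[th thP] : forall kx : R * R, exists l,
    c <= kx.1 -> thetaP kx.1 kx.2 l.
  (* For [k] below [c] the angle gets the default value 0. *)
  move=> [k x] /=; have [ck|] := boolP (c <= k); last by exists 0.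
  have [j|l lP] := @geometric_cauchy (prufer_picard k ^~ x) (k * X * E x).
    by rewrite mulrAC; exact: prufer_picard_cauchy.
  by exists l.
exists (fun k x => th (k, x)).
have thE k x : c <= k -> thetaP k x (th (k, x)) by exact: (thP (k, x)).
have cth k : c <= k -> continuous (fun x => th (k, x)).
  move=> ck x; apply/cvgrPdist_lt => e e0.
  have k0 : 0 < k by exact: lt_le_trans ck.
  pose P := prim (fun t => k * D t + k^-1 * `|W t|).
  have lP : L1 (fun t => k * D t + k^-1 * `|W t|).
    by apply: L1D; apply: L1Z => //; exact: L1_norm.
  have thP' y : `|th (k, x) - th (k, y)| <= `|P x - P y|.
    apply: (@ler_geometric _ _ (2 * (k * X * E x) + 2 * (k * X * E y))) => j.
    rewrite mulrDl; apply: dist_le_via (thE k x ck j) (thE k y ck j) _.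
    exact: prufer_picard_dist.
  have /cvgrPdist_lt/(_ _ e0) := prim_continuous lP (x := x).
  by apply: filterS => y; exact: le_lt_trans.
split=> [k ck|k ck|x].
- have k0 : 0 < k by exact: lt_le_trans ck.
  suff thI x : th (k, x) = prim (prufer_field k (fun t => th (k, t))) x.
    split; first exact/L1_prufer_field/cth.
    by move=> x y; rewrite !thI.
  apply/eqP; rewrite -subr_eq0 -normr_le0.
  pose N := 2 * (k * X).
  have N0 : 0 <= N by rewrite mulr_ge0// mulr_ge0// ltW.
  (* The limit is compared with its image under the integral operator through iterate [j.+1]. The
     tail bound and the contraction each give half of [N * E x / 2 ^+ j]. *)
  apply: (@ler_geometric _ _ (N * E x)) => j; rewrite add0r.
  rewrite (le_trans (ler_distD (prufer_picard k j.+1 x) _ _))//.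
  rewrite [leRHS]splitr lerD//.
    rewrite (le_trans (thE k x ck _))// exprSr /N invfM; lra.
  rewrite /= (le_trans (@prufer_step k _ _ (N / 2 ^+ j) x ck _ _ _ _))//.
  + by rewrite divr_ge0// exprn_ge0.
  + exact: prufer_picard_continuous.
  + exact: cth.
  + move=> t; rewrite distrC (le_trans (thE k t ck _))// /N; lra.
  + lra.
- apply/eqP; rewrite -normr_le0.
  apply: (@ler_geometric _ _ (2 * (k * X * E 0))) => j; rewrite add0r.
  have := thE k 0 ck j; case: j => [|j]; first by rewrite subr0.
  rewrite /= prim_prufer_field; last exact: prufer_picard_continuous.
  rewrite !prim_eq0 ?mulr0 ?subr0//.
    by move=> t t0; rewrite W0 ?mulr0.
  by move=> t t0; rewrite /D indicE memNset//= in_itv/= ltNge t0.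
exists (L * E x) => k l ck cl.
apply: (@ler_geometric _ _ (2 * (k * X * E x) + 2 * (l * X * E x))) => j.
rewrite mulrDl; apply: dist_le_via (thE k x ck j) (thE l x cl j) _.
rewrite (mulrAC L); exact: prufer_picard_lipschitz.
Qed.

End picard.

(** * From the Pruefer angle to a nonzero solution of the Schroedinger equation *)

Section eigenfunction.
Context {R : realType}.
Notation mu := (@lebesgue_measure R).

Lemma is_prim_is_derive (F f : R -> R) (x d : R) : is_prim F f ->
  derivable (prim f) x 1 /\ derive1 (prim f) x = d -> is_derive x (1 : R) F d.
Proof.
move=> [_ FE] [df dfE].
have -> : F = prim f + cst (F 0 - prim f 0).
  by apply/funext => y; rewrite !fctE; have := FE 0 y; lra.
have ? : is_derive x (1 : R) (prim f) d by split; [exact: df|rewrite -derive1E].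
by apply: is_derive_eq; rewrite addr0.
Qed.

Lemma is_prim_ae (F f : R -> R) : is_prim F f ->
  {ae mu, forall x, is_derive x (1 : R) F (f x)}.
Proof.
move=> FP; have [lf _] := FP.
have locf : locally_integrable [set: R] f.
  exact: open_integrable_locally openT lf.
have := @FTC1Ny R f (fun y => L1_sub (measurable_itv _) lf) locf.
apply: filterS; first exact: (ae_filter_ringOfSetsType mu).
by move=> x; exact: is_prim_is_derive.
Qed.

Lemma is_prim_derive (F f : R -> R) (x : R) : is_prim F f ->
  {for x, continuous f} -> is_derive x (1 : R) F (f x).
Proof.
move=> FP cf; have [lf _] := FP.
have xx1 : x < x + 1 by rewrite ltrDl.
apply: (is_prim_is_derive FP).
apply: (@continuous_FTC1 R f -oo%O x (x + 1) xx1 (L1_sub (measurable_itv _) lf)) => //.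
exact: ltNyr.
Qed.

(** The increments over disjoint intervals sum to at most the integral of [|f|] over their union,
    which is small when the union has small measure. *)
Lemma is_prim_AC (F f : R -> R) a b :
  is_prim F f -> absolutely_continuous a b F.
Proof.
move=> [lf FE] e e0.
have [d [d0 fd]] := integral_normr_continuous lf e0.
exists d => // n s t st tst std.
have lf' := L1_norm lf.
pose A i : set R := [set` `]s i, t i[].
have mA i : measurable (A i) by exact: measurable_itv.
have FA i : `|F (t i) - F (s i)| <= \int[mu]_(x in A i) `|f x|.
  have [_ [/ltW sti _]] := st i.
  rewrite FE prim_diff// /A Rintegral_itv_bndo_bndc; last exact: L1_sub.
  by apply: le_normr_Rintegral => //; exact: L1_sub.
apply: le_lt_trans (ler_sum _ (fun i _ => FA i)) _.
have -> : \sum_(i < n) \int[mu]_(x in A i) `|f x| =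
    \int[mu]_(x in \big[setU/set0]_(i < n) A i) `|f x|.
  rewrite /Rintegral integral_bigsetU_EFin//.
  - rewrite -sum_fine//.
    move=> i _; apply: integrable_fin_num; [exact: mA|exact: (L1_sub (mA i) lf')].
  - exact: index_enum_uniq.
  - by apply: sub_trivIset tst.
  - apply: (measurable_int mu); apply: (L1_sub _ lf').
    by apply: bigsetU_measurable => i _; exact: mA.
apply: fd; first by apply: bigsetU_measurable => i _; exact: mA.
rewrite measure_bigsetU_ord//.
rewrite (eq_bigr (fun i => (t i - s i)%:E)) ?sumEFin ?lte_fin// => i _.
by rewrite /= /A lebesgue_measure_itv/= lte_fin; have [_ [-> _]] := st i.
Qed.

Variables (X k : R) (W th : R -> R).
Hypotheses (X0 : 0 < X) (k0 : 0 < k) (LW : L1 W).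
Let D : R -> R := \1_`]0, X].
Hypothesis (thP : is_prim th (prufer_field X W k th)).

Let LD : L1 D. Proof. exact: integrable_indic_itv. Qed.

Let cth : continuous th. Proof. exact: is_prim_continuous thP. Qed.

(** Logarithmic derivative of the Pruefer amplitude: $r'/r = (W/k)\sin\theta\cos\theta$, so that
    [expR (prim g x)] is r. *)
Let g t := k^-1 * (sin (th t) * cos (th t) * W t).

Let Lg : L1 g.
Proof.
apply: L1Z; apply: (@L1_bounded_mul _ _ _ 1 _ _ LW); last first.
  by move=> x; rewrite normrM mulr_ile1// ?norm_sin_le1 ?norm_cos_le1.
apply: measurable_realfun.continuous_measurable_fun => x.
by apply: cvgM; (apply: continuous_comp; first exact: cth);
  [exact: continuous_sin|exact: continuous_cos].
Qed.

Definition prufer_fun x := expR (prim g x) * sin (th x).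
Definition prufer_dfun x := k * (expR (prim g x) * cos (th x)).

(** In the product rule the terms with [W] from the amplitude and from the angle cancel. *)
Lemma prufer_fun_prim : is_prim prufer_fun (fun t => D t * prufer_dfun t).
Proof.
have := is_primM (is_prim_expR (is_prim_prim Lg)) (is_prim_sin thP).
congr is_prim; apply/funext => t.
by rewrite /prufer_dfun /g /prufer_field -/D; ring.
Qed.

Lemma prufer_dfun_prim :
  is_prim prufer_dfun (fun t => (W t - k ^+ 2 * D t) * prufer_fun t).
Proof.
have := is_primM (is_prim_expR (is_prim_prim Lg)) (is_prim_cos thP).
move=> /(is_primZ k).
congr is_prim; apply/funext => t.
rewrite /prufer_fun /g /prufer_field -/D.
have cs : cos (th t) ^+ 2 = 1 - sin (th t) ^+ 2.
  by rewrite -(cos2Dsin2 (th t)) addrK.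
set s := sin (th t) in cs *; set c := cos (th t) in cs *; set r := expR _.
(* Here the terms with [W] do not cancel: those of the amplitude carry $\cos^2$, those of the angle
   $\sin^2$, and together they give [W] times the solution. *)
transitivity ((r * s * W t) * (c ^+ 2 + s ^+ 2) - k ^+ 2 * D t * (r * s)).
  by field; rewrite gt_eqF.
by rewrite cs; ring.
Qed.

(** The derivative exists at every interior point, not only almost everywhere, because the integrand
    [D * prufer_dfun] is continuous where [D] is locally 1. *)
Lemma prufer_fun_derive x : 0 < x < X ->
  is_derive x (1 : R) prufer_fun (prufer_dfun x).
Proof.
move=> xX; have Dnear : \forall y \near x, D y = 1.
  have : x \in `]0, X[ by rewrite in_itv.
  move=> /near_in_itvoo; apply: filterS => y; rewrite in_itv/= => /andP[y0 yX].
  by rewrite /D indicE mem_set//= in_itv/= y0 ltW.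
have Dx : D x = 1 by exact: nbhs_singleton Dnear.
have := @is_prim_derive _ _ x prufer_fun_prim.
rewrite Dx mul1r; apply.
have cd := is_prim_continuous prufer_dfun_prim (x := x).
rewrite /prop_for /continuous_at Dx mul1r.
apply: cvg_trans cd; apply: near_eq_cvg.
by apply: filterS Dnear => y ->; rewrite mul1r.
Qed.

(** If the function vanished on $[0,X]$, it and its derivative would both be 0 at the midpoint, so
    sine and cosine of the angle would vanish together, the amplitude being positive. *)
Lemma prufer_fun_neq0 : exists2 x, 0 <= x <= X & prufer_fun x != 0.
Proof.
apply: contrapT => H.
have u0 x : 0 <= x <= X -> prufer_fun x = 0.
  by move=> xX; apply/eqP/negPn/negP => ux; apply: H; exists x.
pose m := X / 2; have m0 : 0 < m < X by rewrite /m; move: X0; lra.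
have um : prufer_fun m = 0 by apply: u0; rewrite /m; move: X0; lra.
have := prufer_fun_derive m0 => -[_].
rewrite (_ : 'D_1 prufer_fun m = 0); last first.
  rewrite -(derive_cst (0:R) m 1); apply: near_eq_derive.
  have : m \in `]0, X[ by rewrite in_itv.
  move=> /near_in_itvoo; apply: filterS => y; rewrite in_itv/= => /andP[y0 yX].
  by rewrite u0// !ltW.
move=> /esym/eqP; rewrite /prufer_dfun mulf_eq0 gt_eqF//= mulf_eq0 gt_eqF ?expR_gt0//=.
move=> /eqP c0; move: um => /eqP; rewrite /prufer_fun mulf_eq0 gt_eqF ?expR_gt0//=.
move=> /eqP s0; have := cos2Dsin2 (th m); rewrite c0 s0 expr0n/= addr0 => /eqP.
by rewrite eq_sym oner_eq0.
Qed.

End eigenfunction.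

(** * Passage from the completed Lebesgue measure to Borel functions *)

Section completed.
Context {R : realType}.
Notation mu := (@lebesgue_measure R).
Notation cmeasurable := ((@wlength R idfun)^*%mu.-cara.-measurable).

Lemma completed_measurable_borel (A : set R) : cmeasurable A ->
  exists B N : set R, [/\ @measurable _ (measurableTypeR R) B,
    @measurable _ (measurableTypeR R) N, mu N = 0%E, B `<=` A & A `<=` B `|` N].
Proof.
rewrite -completed_caratheodory_measurable g_sigma_completed_algebra_genE.
move=> [B mB [M [N [mN N0 MN]] <-]]; exists B, N; split => //.
by apply: setUS.
Qed.

Lemma borel_completed_measurable (A : set R) :
  @measurable _ (measurableTypeR R) A -> cmeasurable A.
Proof. exact: sub_caratheodory. Qed.

(** Superlevel sets at rational levels are Borel up to null sets. Countably many null sets are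
    collected in [N], and off [N] every superlevel set is a union of the Borel parts at rational
    levels. *)
Lemma completed_measurable_fun_borel (f : R -> R) :
  (forall q : R, cmeasurable (f @^-1` `]q, +oo[)) ->
  exists N : set R, [/\ @measurable _ (measurableTypeR R) N, mu N = 0%E &
    measurable_fun setT (f \_ (~` N) : measurableTypeR R -> R)].
Proof.
(* [r] enumerates the rationals; numbers that code no rational are sent to 0. *)
move=> mf; pose r (n : nat) : R := ratr (odflt 0%Q (unpickle n)).
have /choice[BN BNP] : forall n, exists BN : set R * set R,
    [/\ @measurable _ (measurableTypeR R) BN.1,
    @measurable _ (measurableTypeR R) BN.2, mu BN.2 = 0%E,
    BN.1 `<=` f @^-1` `]r n, +oo[ & f @^-1` `]r n, +oo[ `<=` BN.1 `|` BN.2].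
  move=> n; have [B [N ?]] := completed_measurable_borel (mf (r n)).
  by exists (B, N).
have [N [mN N0 BNN]] : mu.-negligible (\bigcup_n (BN n).2).
  by apply: negligible_bigcup => n; exists (BN n).2; have [_ mN N0 _ _] := BNP n; split.
exists N; split=> //.
apply: (measurability _ (measurable_realfun.RGenOInfty.measurableE R)) => //.
move=> /= _ [_ [x ->] <-]; rewrite setTI.
(* The restricted function is 0 on [N], so [N] belongs to the superlevel set exactly when
   [x < 0]. *)
have -> : (f \_ (~` N)) @^-1` `]x, +oo[ =
    \bigcup_(n in [set n | x <= r n]) ((BN n).1 `\` N) `|`
    (if x < 0 then N else set0).
  apply/seteqP; split=> t /=.
    rewrite in_itv/= andbT patchE; case: ifPn => [|tN].
      rewrite inE => tN xt; left.
      have [q /=] := rat_in_itvoo xt; rewrite in_itv/= => /andP[xq qt].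
      have rq : r (pickle q) = ratr q by rewrite /r pickleK.
      exists (pickle q) => /=; first by rewrite rq ltW.
      split => //; have [_ _ _ _ H] := BNP (pickle q).
      have [|//|Nt] := H t; first by rewrite /= in_itv/= rq qt.
      by exfalso; apply: tN; apply: BNN; exists (pickle q).
    by move=> ->; right; move: tN; rewrite notin_setE => /contrapT.
  rewrite in_itv/= andbT patchE => -[[n /= xn [Bt Nt]]|].
    rewrite mem_set//; have [_ _ _ H _] := BNP n.
    by have := H t Bt; rewrite /= in_itv/= andbT; exact: le_lt_trans.
  by case: ifPn => // x0 Nt; rewrite memNset//=; exact.
apply: measurableU; last by case: ifP.
apply: bigcup_measurable => n _; apply: measurableD => //.
by have [] := BNP n.
Qed.

Lemma completed_ae (P : set R) : {ae mu, forall x, P x} ->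
  {ae leb R, forall x, P x}.
Proof.
move=> [A [mA A0 PA]]; exists A; split => //; exact: borel_completed_measurable.
Qed.

Lemma completed_measurable_fun (f : R -> R) :
  measurable_fun setT (f : measurableTypeR R -> R) ->
  measurable_fun setT (f : (@caratheodory_type _ _ (wlength idfun)^*%mu) -> R).
Proof.
move=> mf _ Y mY; rewrite setTI; apply: borel_completed_measurable.
by rewrite -[X in measurable X]setTI; exact: mf.
Qed.

(** The identity is measurable from the completed to the Borel sigma-algebra and pushes the
    completed measure forward to [mu]. *)
Lemma completed_integral (f : R -> R) :
  measurable_fun setT (f : measurableTypeR R -> R) -> (forall x, 0 <= f x) ->
  (\int[leb R]_x (f x)%:E = \int[mu]_x (f x)%:E)%E.
Proof.
move=> mf f0.
have mid : measurable_fun setT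
    (id : (@caratheodory_type _ _ (wlength idfun)^*%mu) -> measurableTypeR R).
  by move=> _ Y mY; rewrite setTI; exact: borel_completed_measurable.
have /measurable_realfun.measurable_EFinP mEf := mf.
have := ge0_integral_pushforward mid (leb R) measurableT mEf.
rewrite preimage_setT => <-; last by move=> y _; rewrite lee_fin.
apply: eq_measure_integral => A mA _.
by [].
Qed.

(** [V] is set to 0 outside $(0,X)$ and on a Borel null set. This can only decrease [|V|] pointwise,
    and an upper bound on the integral of [|W|] is all that the angle estimate calls for. *)
Lemma borel_representative (V : R -> R) (X : R) :
  (leb R).-integrable `]0, X[ (EFin \o V) ->
  exists W : R -> R, [/\ L1 W, forall t, t <= 0 -> W t = 0,
    {ae leb R, forall t, 0 < t < X -> W t = V t} &
    \int[mu]_t `|W t| <= \int[leb R]_(t in `]0, X[) `|V t|].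
Proof.
move=> iV.
have mI : (wlength idfun)^*%mu.-cara.-measurable [set` `]0, X[].
  apply: borel_completed_measurable; exact: measurable_itv.
pose V0 := V \_ `]0, X[.
have iV0 : (leb R).-integrable setT (EFin \o V0).
  have := (integrable_mkcond (mu := leb R) (EFin \o V) mI).1 iV.
  by rewrite restrict_EFin.
have mV0 : measurable_fun setT
    (V0 : (@caratheodory_type _ _ (wlength idfun)^*%mu) -> R).
  by apply/measurable_realfun.measurable_EFinP; exact: (measurable_int (leb R)).
have [N [mN N0 mW]] : exists N : set R,
    [/\ @measurable _ (measurableTypeR R) N, mu N = 0%E &
    measurable_fun setT (V0 \_ (~` N) : measurableTypeR R -> R)].
  apply: completed_measurable_fun_borel => q.
  by rewrite -[X in measurable X]setTI; apply: mV0.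
pose W := V0 \_ (~` N).
have WV0 t : `|W t| <= `|V0 t|.
  by rewrite /W patchE; case: ifP => //; rewrite normr0.
have mnW : measurable_fun setT (fun t => `|W t| : measurableTypeR R).
  exact: measurableT_comp.
have intW : (\int[mu]_t `|W t|%:E <= \int[leb R]_(t in `]0%R, X[) `|V t|%:E)%E.
  rewrite -completed_integral//.
  rewrite [leRHS]integral_mkcond.
  rewrite (_ : _ \_ _ = (fun t => `|V0 t|%:E)); last first.
    apply/funext => t; rewrite /V0 !patchE.
    by case: ifP => //; rewrite normr0.
  apply: ge0_le_integral; [exact: measurableT|by move=> t _; rewrite lee_fin| | |].
  - apply/measurable_realfun.measurable_EFinP.
    exact: completed_measurable_fun.
  - apply/measurable_realfun.measurable_EFinP.
    by apply: measurableT_comp; [exact: measurable_realfun.normr_measurable|exact: mV0].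
  - by move=> t _; rewrite lee_fin.
have intV : (\int[leb R]_(t in `]0%R, X[) `|V t|%:E < +oo)%E.
  by have /integrableP[] := iV.
have iW : L1 W.
  apply/integrableP; split; first exact/measurable_realfun.measurable_EFinP.
  exact: (le_lt_trans intW intV).
exists W; split=> //.
- move=> t t0; rewrite /W patchE; case: ifP => // _.
  by rewrite /V0 patchE memNset//= in_itv/= ltNge t0.
- apply: completed_ae; exists N; split => // t /=.
  move=> H; apply: contrapT => Nt; apply: H => tX.
  by rewrite /W patchE mem_set// /V0 patchE mem_set//= in_itv.
rewrite /Rintegral fine_le//.
- by rewrite ge0_fin_numE ?(le_lt_trans intW)// integral_ge0.
- by rewrite ge0_fin_numE// integral_ge0.
Qed.

End completed.

(** * The angle estimate and the eigenvalue criterion *)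

Section eigenvalue.
Context {R : realType}.
Notation mu := (@lebesgue_measure R).

Lemma norm_maxB_le (c x y : R) :
  `|Num.max c x - Num.max c y| <= `|x - y|.
Proof.
have := ler_norm (x - y); have := ler_norm (y - x); rewrite (distrC y).
rewrite ler_norml; case: (leP c x); case: (leP c y); lra.
Qed.

Lemma sin_intpi (z : int) : sin (z%:~R * pi) = 0 :> R.
Proof.
have nat n : sin (n%:R * pi) = 0 :> R.
  elim: n => [|n IH]; first by rewrite mul0r sin0.
  by rewrite -natr1 mulrDl mul1r sinDpi IH oppr0.
by case: z => n; [exact: nat|rewrite NegzE mulrNz mulNr sinN nat oppr0].
Qed.

Lemma continuous_bounded_L2 (X M : R) (u : R -> R) :
  continuous u -> (forall x, `|u x| <= M) -> L2 X u.
Proof.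
move=> cu uM.
have mI : (wlength idfun)^*%mu.-cara.-measurable [set` `]0, X[].
  by apply: borel_completed_measurable; exact: measurable_itv.
have mcu : measurable_fun setT
    (u : (@caratheodory_type _ _ (wlength idfun)^*%mu) -> R).
  apply: completed_measurable_fun.
  exact: measurable_realfun.continuous_measurable_fun.
have mf : measurable_fun setT
    (u \_ `]0, X[ : (@caratheodory_type _ _ (wlength idfun)^*%mu) -> R).
  by apply/(measurable_restrictT _ mI); exact: measurable_funTS.
rewrite /L2 inE; apply/andP; split; first by rewrite inE.
rewrite !inE/= /finite_norm unlock /Lnorm poweR_lty//.
rewrite (_ : (fun x => _) = (fun x => (u x ^+ 2)%:E) \_ `]0, X[); last first.
  apply/funext => x; rewrite /= !patchE; case: ifP => _; last first.
    by rewrite normr0 powR0.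
  by rewrite -[2]/(2%:R) powR_mulrn// real_normK ?num_real.
rewrite -integral_mkcond.
apply: (@le_lt_trans _ _ (\int[leb R]_(x in `]0%R, X[) (M ^+ 2)%:E)%E).
  apply: ge0_le_integral.
  - exact: mI.
  - by move=> x _; rewrite lee_fin sqr_ge0.
  - apply/measurable_realfun.measurable_EFinP.
    by apply: measurable_realfun.measurable_funX; exact: measurable_funTS.
  - exact: measurable_cst.
  - move=> x _; rewrite lee_fin -[u x ^+ 2]real_normK ?num_real//.
    by rewrite lerXn2r ?nnegrE// (le_trans _ (uM x)).
rewrite integral_cst//; set m := (X in (_ * X)%E).
have -> : m = @lebesgue_measure R [set` `]0, X[] by [].
rewrite lebesgue_measure_itv/=; case: ifP => _; last by rewrite mule0.
by rewrite -EFinB -EFinM ltry.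
Qed.

Lemma prim_indic (X : R) : 0 < X -> prim (\1_`]0, X] : R -> R) X = X.
Proof.
move=> X0; rewrite /prim /Rintegral integral_indic//= setIidl.
  by rewrite lebesgue_measure_itv/= lte_fin X0 oppr0 adde0.
by move=> t /=; rewrite !in_itv/= => /andP[].
Qed.

(** Integrate the angle equation over $(0,X]$: the constant term gives exactly [k * X], and the
    squared sine in the remainder is at most 1. *)
Lemma prufer_angle_estimate (X k : R) (W th : R -> R) :
  0 < X -> 0 < k -> L1 W -> (forall t, t <= 0 -> W t = 0) ->
  is_prim th (prufer_field X W k th) -> th 0 = 0 ->
  `|th X - k * X| <= k^-1 * \int[mu]_t `|W t|.
Proof.
move=> X0 k0 LW W0 thP th0; have [_ thE] := thP.
have cth := is_prim_continuous thP.
have ls := L1_sqr_sin LW cth.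
have D0 : prim (\1_`]0, X] : R -> R) 0 = 0.
  apply: prim_eq0 => // t t0.
  by rewrite indicE memNset//= in_itv/= ltNge t0.
have S0 : prim (fun t => sin (th t) ^+ 2 * W t) 0 = 0.
  by apply: prim_eq0 => // t t0; rewrite W0 ?mulr0.
rewrite -[th X]subr0 -th0 thE !prim_prufer_field// prim_indic// D0 S0.
rewrite !mulr0 !subr0.
rewrite addrAC subrr sub0r normrN normrM gtr0_norm ?invr_gt0//.
rewrite ler_wpM2l ?invr_ge0 ?(ltW k0)//.
rewrite (le_trans (prim_le_norm _ ls))// (le_trans (prim_norm_le_int _ ls))//.
apply: le_Rintegral => //; [exact: L1_norm|exact: L1_norm|].
by move=> t _; rewrite normrM ler_piMl// norm_sqr_sin_le1.
Qed.

(** The eigenfunction $r\sin\theta$ satisfies both boundary conditions because the sine of the angle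
    vanishes at 0 and at [X]. *)
Lemma prufer_eigenvalue (X k : R) (V W th : R -> R) : 0 < X -> 0 < k -> L1 W ->
  {ae leb R, forall t, 0 < t < X -> W t = V t} ->
  is_prim th (prufer_field X W k th) -> th 0 = 0 -> sin (th X) = 0 ->
  schrodinger_eigenvalue V X (k ^+ 2).
Proof.
move=> X0 k0 LW WV thP th0 thX.
have uP := prufer_fun_prim LW thP.
have vP := prufer_dfun_prim k0 LW thP.
set u := prufer_fun k W th in uP vP; set v := prufer_dfun k W th in uP vP.
have cu := is_prim_continuous uP.
have [M uM] := is_prim_bounded uP.
exists u; first exact: (prufer_fun_neq0 X0 k0 LW thP).
split.
- exact: (continuous_bounded_L2 X cu uM).
- apply: (@continuous_bounded_L2 X (k ^+ 2 * M)).
    by move=> x; apply: cvgM; [exact: cvg_cst|exact: cu].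
  by move=> x; rewrite normrM ger0_norm ?sqr_ge0// ler_wpM2l ?sqr_ge0.
- by rewrite /u /prufer_fun th0 sin0 mulr0.
- by rewrite /u /prufer_fun thX mulr0.
exists v; split; [exact: is_prim_AC uP|exact: is_prim_AC vP| |].
  by move=> x; exact: (prufer_fun_derive k0 LW thP).
have := completed_ae (is_prim_ae vP).
move: WV; apply: filterS2; first exact: (ae_filter_ringOfSetsType (leb R)).
move=> x Wx [dv dvE] x0X; split=> //.
rewrite derive1E dvE Wx// indicE mem_set /=; first by ring.
by case/andP: x0X => x0 xX; rewrite in_itv/= x0 ltW.
Qed.

End eigenvalue.

(** * The choice of h and the intermediate value argument in k *)

Theorem theorem1p1 (R : realType) (V : R -> R)
    (V_int : forall x : R, 0 < x -> (leb R).-integrable `]0, x[ (EFin \o V))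
    (a : R) (a_gt0 : 0 < a) :
  exists h : R -> R,
    h =O_ (+oo_R)
      (fun x => x^-1 * (1 + \int[leb R]_(t in `]0, x[) `|V t|)) /\
    forall X alpha beta : R, 0 < X -> a <= alpha -> alpha <= beta ->
      h X <= beta - alpha ->
      exists2 E : R, alpha ^+ 2 / 4 <= E <= beta ^+ 2 / 4 &
        schrodinger_eigenvalue V X E.
Proof.
pose I x := \int[leb R]_(t in `]0, x[) `|V t|.
have I0 x : 0 <= I x by exact: Rintegral_ge0.
(* With this [h], the condition [h X <= beta - alpha] says $(\beta-\alpha)X \ge 2\pi +
   (8/a)\int_0^X|V|$. *)
exists (fun x => x^-1 * (2 * pi + 8 / a * I x)); split.
  have pi0 := pi_ge0 R.
  have a80 : 0 <= 8 / a by rewrite divr_ge0// ltW.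
  apply/eqOP; near=> K; near=> x.
  have x0 : 0 < x by near: x; exact: (nbhs_pinfty_gt (num_real _)).
  rewrite -/(I x).
  have K0 : 2 * pi + 8 / a <= K by near: K; exact: nbhs_pinfty_ge (num_real _).
  rewrite !normrM mulrCA ler_wpM2l// !ger0_norm; last 2 first.
  - by rewrite addr_ge0.
  - by rewrite addr_ge0// mulr_ge0.
  apply: (@le_trans _ _ ((2 * pi + 8 / a) * (1 + I x))); last first.
    by rewrite ler_wpM2r// addr_ge0.
  have := I0 x; nra.
move=> X alpha beta X0 aal albe hX.
(* Every k in $[\alpha/2,\beta/2]$ is at least [c = a / 2], the lower bound under which the angle is
   constructed. *)
have [W [LW W0 WV WI]] := borel_representative (V_int X X0).
pose c := a / 2; have c0 : 0 < c by rewrite divr_gt0.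
have [th [thP th0 thL]] := prufer_angle_exists X0 c0 LW W0.
pose k1 := alpha / 2; pose k2 := beta / 2.
have ck1 : c <= k1 by rewrite /c /k1; lra.
have k12 : k1 <= k2 by rewrite /k1 /k2; lra.
have ck2 : c <= k2 by exact: le_trans k12.
have est k : c <= k -> `|th k X - k * X| <= 2 / a * I X.
  move=> ck; have k0 : 0 < k by exact: lt_le_trans ck.
  have := prufer_angle_estimate X0 k0 LW W0 (thP k ck) (th0 k ck).
  move=> /le_trans; apply.
  rewrite ler_pM ?invr_ge0 ?(ltW k0)//; first exact: Rintegral_ge0.
  by rewrite (_ : 2 / a = c^-1) ?lef_pV2 ?posrE// /c; field; rewrite gt_eqF.
(* The linear parts differ by $(\beta-\alpha)X/2 \ge \pi + (4/a)\int_0^X|V|$, and each of the two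
   estimates loses at most $(2/a)\int_0^X|V|$. *)
have gap : pi <= th k2 X - th k1 X.
  have := est k1 ck1; have := est k2 ck2; rewrite !ler_norml.
  move=> /andP[+ _] /andP[_ +].
  have : 2 * pi + 8 / a * I X <= (beta - alpha) * X.
    by rewrite -ler_pdivrMr// mulrC.
  rewrite /k1 /k2; lra.
(* The largest multiple of $\pi$ not exceeding the angle at [k2] is greater than that angle minus
   $\pi$, hence at least the angle at [k1]. *)
pose m := Num.floor (th k2 X / pi).
have /andP[m1 m2] := floor_itv (th k2 X / pi).
have pi0 := pi_gt0 R.
have mk2 : m%:~R * pi <= th k2 X by rewrite -ler_pdivlMr.
have mk1 : th k1 X <= m%:~R * pi.
  move: m2; rewrite intrD ltr_pdivrMr// mulrDl mul1r -/m; lra.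
(* The angle is controlled only for [k] at least [c]; clamping the parameter at [c] gives a function
   continuous on the whole line. *)
pose phi k := th (Num.max c k) X.
have phiE k : c <= k -> phi k = th k X by move=> ck; rewrite /phi (max_idPr ck).
have cphi : continuous phi.
  have [K KP] := thL X; move=> x; apply/cvgrPdist_lt => e e0.
  have K0 : 0 < `|K| + 1 by rewrite ltr_pwDr.
  near=> y; rewrite /phi (le_lt_trans (KP _ _ _ _)) ?le_max ?lexx//.
  apply: (@le_lt_trans _ _ ((`|K| + 1) * `|x - y|)).
    rewrite (le_trans (ler_wpM2r (normr_ge0 _) (ler_norm K)))//.
    by rewrite ler_pM ?lerDl// norm_maxB_le.
  rewrite -ltr_pdivlMl//; near: y.
  by apply: cvgr_dist_lt; rewrite // mulr_gt0// invr_gt0.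
have [||k] := @IVT R phi k1 k2 (m%:~R * pi) k12.
- exact: continuous_subspaceT.
- by rewrite !phiE// ge_min le_max mk1 mk2 orbT.
rewrite in_itv/= => /andP[k1k kk2] thk.
have ck : c <= k by exact: le_trans k1k.
rewrite phiE// in thk.
have k0 : 0 < k by exact: lt_le_trans ck.
exists (k ^+ 2).
  have -> : alpha ^+ 2 / 4 = k1 ^+ 2 by rewrite /k1; field.
  have -> : beta ^+ 2 / 4 = k2 ^+ 2 by rewrite /k2; field.
  have k10 : 0 <= k1 by rewrite (le_trans (ltW c0)).
  by rewrite !ler_sqr ?nnegrE ?k1k ?kk2 ?(ltW k0)// (le_trans k10).
apply: (prufer_eigenvalue X0 k0 LW WV (thP k ck) (th0 k ck)).
by rewrite thk sin_intpi.
Unshelve. all: by end_near.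
Qed.
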